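(* Let $k\ge2$, let $X$ be a $G_1$-space and $Y$ a $G_2$-space, and let $G_1\times G_2$ act on $X\times Y$ componentwise. If $X^k\times Y^k$ is a $(G_1\times G_2)$-completely normal space, then $$\mathrm{TC}_{k,G_1\times G_2}^{\#}(X\times Y)\le \mathrm{TC}_{k,G_1}^{\#}(X)+\mathrm{TC}_{k,G_2}^{\#}(Y)-1 .$$ If $X^k\times Y^k$ is $(G_1^k\times G_2^k)$-completely normal, then $$\mathrm{TC}_{k,G_1\times G_2}^{\#,*}(X\times Y)\le \mathrm{TC}_{k,G_1}^{\#,*}(X)+\mathrm{TC}_{k,G_2}^{\#,*}(Y)-1 .$$
   Context: $X^I$ is the space of paths $[0,1]\to X$ with the compact-open topology, and $e_{k,X}\colon X^I\to X^k$ is $e_{k,X}(\alpha)=\left(\alpha(0),\alpha(\tfrac1{k-1}),\dots,\alpha(\tfrac{k-2}{k-1}),\alpha(1)\right)$. For a $G$-space $X$: $\mathrm{TC}_{k,G}^{\#}(X)$ is the smallest $n$ such that $X^k$ has an open cover by $n$ sets invariant under the diagonal $G$-action, over each of which $e_{k,X}$ has a continuous (not necessarily equivariant) section; $\mathrm{TC}_{k,G}^{\#,*}(X)$ is the analogous number using sets invariant under the componentwise $G^k$-action. Both are $\infty$ if no such $n$ exists. A $G$-space $Z$ is $G$-completely normal if for any two $G$-invariant subsets $A,B\subseteq Z$ with $\overline A\cap B=A\cap\overline B=\emptyset$ there exist disjoint $G$-invariant open subsets $U\supseteq A$, $V\supseteq B$. In the first statement $G_1\times G_2$ acts on $X^k\times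 Y^k$ with $G_1$ acting diagonally on $X^k$ and $G_2$ diagonally on $Y^k$; in the second, $G_1^k$ and $G_2^k$ act componentwise on $X^k$ and $Y^k$. *)

(* Defs.v *)
From HB Require Import structures.
From mathcomp Require Import all_boot all_order all_algebra.
From mathcomp Require Import all_classical all_reals all_analysis.

Set Implicit Arguments.
Unset Strict Implicit.
Unset Printing Implicit Defensive.

Import Order.TTheory GRing.Theory Num.Theory.
Import numFieldNormedType.Exports.

Local Open Scope classical_set_scope.
Local Open Scope ring_scope.

HB.mixin Record isTopologicalGroup G & Topological G & monoid.Group G := {
  mulg_continuous : continuous (fun p : G * G => (p.1 * p.2)%g);
  invg_continuous : continuous (fun x : G => (x^-1)%g)
}.

#[short(type="topologicalGroupType")]
HB.structure Definition TopologicalGroup :=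
  {G of isTopologicalGroup G & Topological G & monoid.Group G}.

Section continuity.
Context {S T U : topologicalType}.

Lemma continuous_pair (f : S -> T) (g : S -> U) :
  continuous f -> continuous g -> continuous (fun x => (f x, g x)).
Proof. by move=> cf cg x; apply: cvg_pair; [exact: cf | exact: cg]. Qed.

Lemma continuous_comp_fun (f : S -> T) (g : T -> U) :
  continuous f -> continuous g -> continuous (fun x => g (f x)).
Proof. by move=> cf cg x; apply: continuous_comp; [exact: cf | exact: cg]. Qed.

Lemma continuous_fst : continuous (@fst S T).
Proof. by move=> x; exact: cvg_fst. Qed.

Lemma continuous_snd : continuous (@snd S T).
Proof. by move=> x; exact: cvg_snd. Qed.

Lemma continuous_ptws (I : Type) (f : S -> {ptws I -> T}) :
  (forall i, continuous (fun x => f x i)) -> continuous f.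
Proof.
move=> cf x; apply/cvg_sup => i A [V] [[W] oW <-] WfN WA.
rewrite /=; apply: (filterS WA); apply: (cf i x).
by apply: open_nbhs_nbhs; split.
Qed.

Lemma continuous_ptws_proj (I : eqType) (i : I) :
  continuous (fun f : {ptws I -> T} => f i).
Proof. exact: (@proj_continuous I (fun=> T) i). Qed.

End continuity.

Section prod_topological_group.
Context {G H : topologicalGroupType}.

Lemma pair_mulg_continuous :
  continuous (fun p : (G * H) * (G * H) => (p.1 * p.2)%g).
Proof.
apply: continuous_pair.
- apply: (@continuous_comp_fun _ _ _ (fun p : (G * H) * (G * H) =>
    (p.1.1, p.2.1)) _ _ mulg_continuous).
  apply: continuous_pair.
  + exact: (continuous_comp_fun continuous_fst continuous_fst).
  + exact: (continuous_comp_fun continuous_snd continuous_fst).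
- apply: (@continuous_comp_fun _ _ _ (fun p : (G * H) * (G * H) =>
    (p.1.2, p.2.2)) _ _ mulg_continuous).
  apply: continuous_pair.
  + exact: (continuous_comp_fun continuous_fst continuous_snd).
  + exact: (continuous_comp_fun continuous_snd continuous_snd).
Qed.

Lemma pair_invg_continuous : continuous (fun x : G * H => (x^-1)%g).
Proof.
apply: continuous_pair.
- exact: (continuous_comp_fun continuous_fst invg_continuous).
- exact: (continuous_comp_fun continuous_snd invg_continuous).
Qed.

HB.instance Definition _ := isTopologicalGroup.Build (G * H)%type
  pair_mulg_continuous pair_invg_continuous.

End prod_topological_group.

Section pow_topological_group.
Context {I : eqType} {G : topologicalGroupType}.
Implicit Types f g : {ptws I -> G}.

Definition ptws_mul f g : {ptws I -> G} := fun i => (f i * g i)%g.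
Definition ptws_one : {ptws I -> G} := fun=> 1%g.
Definition ptws_inv f : {ptws I -> G} := fun i => ((f i)^-1)%g.

Lemma ptws_mulgA : associative ptws_mul.
Proof. by move=> f g h; apply/funext => i; exact: mulgA. Qed.

Lemma ptws_mul1g : left_id ptws_one ptws_mul.
Proof. by move=> f; apply/funext => i; exact: mul1g. Qed.

Lemma ptws_mulg1 : right_id ptws_one ptws_mul.
Proof. by move=> f; apply/funext => i; exact: mulg1. Qed.

Lemma ptws_mulVg : left_inverse ptws_one ptws_inv ptws_mul.
Proof. by move=> f; apply/funext => i; exact: mulVg. Qed.

Lemma ptws_mulgV : right_inverse ptws_one ptws_inv ptws_mul.
Proof. by move=> f; apply/funext => i; exact: mulgV. Qed.

HB.instance Definition _ := isGroup.Build {ptws I -> G}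
  ptws_mulgA ptws_mul1g ptws_mulg1 ptws_mulVg ptws_mulgV.

Lemma ptws_mulg_continuous :
  continuous (fun p : {ptws I -> G} * {ptws I -> G} => (p.1 * p.2)%g).
Proof.
apply: continuous_ptws => i.
apply: (@continuous_comp_fun _ _ _ (fun p : {ptws I -> G} * {ptws I -> G} =>
  (p.1 i, p.2 i)) _ _ mulg_continuous).
apply: continuous_pair.
- apply: (@continuous_comp_fun _ _ _ fst (fun f : {ptws _ -> _} => f i)).
    exact: continuous_fst.
  exact: continuous_ptws_proj.
- apply: (@continuous_comp_fun _ _ _ snd (fun f : {ptws _ -> _} => f i)).
    exact: continuous_snd.
  exact: continuous_ptws_proj.
Qed.

Lemma ptws_invg_continuous : continuous (fun f : {ptws I -> G} => (f^-1)%g).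
Proof.
apply: continuous_ptws => i.
apply: (@continuous_comp_fun _ _ _ (fun f : {ptws I -> G} => f i) _ _
  invg_continuous).
exact: continuous_ptws_proj.
Qed.

HB.instance Definition _ := isTopologicalGroup.Build {ptws I -> G}
  ptws_mulg_continuous ptws_invg_continuous.

End pow_topological_group.

Record gaction (G : topologicalGroupType) (X : topologicalType) := GAction {
  gact :> G -> X -> X;
  gact1 : forall x, gact 1%g x = x;
  gactM : forall g h x, gact (g * h)%g x = gact g (gact h x);
  gact_continuous : continuous (fun p : G * X => gact p.1 p.2)
}.

Section prod_gaction.
Context {G H : topologicalGroupType} {X Y : topologicalType}.
Variables (a : gaction G X) (b : gaction H Y).

Definition prod_act (g : G * H) (p : X * Y) : X * Y := (a g.1 p.1, b g.2 p.2).

Lemma prod_act1 p : prod_act 1%g p = p.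
Proof. by case: p => x y; rewrite /prod_act /= !gact1. Qed.

Lemma prod_actM g h p : prod_act (g * h)%g p = prod_act g (prod_act h p).
Proof. by rewrite /prod_act /= !gactM. Qed.

Lemma prod_act_continuous :
  continuous (fun p : (G * H) * (X * Y) => prod_act p.1 p.2).
Proof.
apply: continuous_pair.
- apply: (@continuous_comp_fun _ _ _ (fun p : (G * H) * (X * Y) =>
    (p.1.1, p.2.1)) _ _ (@gact_continuous _ _ a)).
  apply: continuous_pair.
  + exact: (continuous_comp_fun continuous_fst continuous_fst).
  + exact: (continuous_comp_fun continuous_snd continuous_fst).
- apply: (@continuous_comp_fun _ _ _ (fun p : (G * H) * (X * Y) =>
    (p.1.2, p.2.2)) _ _ (@gact_continuous _ _ b)).
  apply: continuous_pair.
  + exact: (continuous_comp_fun continuous_fst continuous_snd).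
  + exact: (continuous_comp_fun continuous_snd continuous_snd).
Qed.

Definition prod_gaction : gaction (G * H)%type (X * Y)%type :=
  GAction prod_act1 prod_actM prod_act_continuous.

End prod_gaction.

Section power_gactions.
Context {G : topologicalGroupType} {X : topologicalType}.
Variables (k : nat) (a : gaction G X).

Definition diag_act (g : G) (x : {ptws 'I_k -> X}) : {ptws 'I_k -> X} :=
  fun i => a g (x i).

Lemma diag_act1 x : diag_act 1%g x = x.
Proof. by apply/funext => i; exact: gact1. Qed.

Lemma diag_actM g h x : diag_act (g * h)%g x = diag_act g (diag_act h x).
Proof. by apply/funext => i; exact: gactM. Qed.

Lemma diag_act_continuous :
  continuous (fun p : G * {ptws 'I_k -> X} => diag_act p.1 p.2).
Proof.
apply: continuous_ptws => i.
apply: (@continuous_comp_fun _ _ _ (fun p : G * {ptws 'I_k -> X} =>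
  (p.1, p.2 i)) _ _ (@gact_continuous _ _ a)).
apply: continuous_pair; first exact: continuous_fst.
apply: (@continuous_comp_fun _ _ _ snd (fun f : {ptws _ -> _} => f i)).
  exact: continuous_snd.
exact: continuous_ptws_proj.
Qed.

Definition diag_gaction : gaction G {ptws 'I_k -> X} :=
  GAction diag_act1 diag_actM diag_act_continuous.

Definition pow_act (g : {ptws 'I_k -> G}) (x : {ptws 'I_k -> X}) :
    {ptws 'I_k -> X} :=
  fun i => a (g i) (x i).

Lemma pow_act1 x : pow_act 1%g x = x.
Proof. by apply/funext => i; exact: gact1. Qed.

Lemma pow_actM g h x : pow_act (g * h)%g x = pow_act g (pow_act h x).
Proof. by apply/funext => i; exact: gactM. Qed.

Lemma pow_act_continuous :
  continuous (fun p : {ptws 'I_k -> G} * {ptws 'I_k -> X} => pow_act p.1 p.2).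
Proof.
apply: continuous_ptws => i.
apply: (@continuous_comp_fun _ _ _
  (fun p : {ptws 'I_k -> G} * {ptws 'I_k -> X} => (p.1 i, p.2 i))
  _ _ (@gact_continuous _ _ a)).
apply: continuous_pair.
- apply: (@continuous_comp_fun _ _ _ fst (fun f : {ptws _ -> _} => f i)).
    exact: continuous_fst.
  exact: continuous_ptws_proj.
- apply: (@continuous_comp_fun _ _ _ snd (fun f : {ptws _ -> _} => f i)).
    exact: continuous_snd.
  exact: continuous_ptws_proj.
Qed.

Definition pow_gaction : gaction {ptws 'I_k -> G} {ptws 'I_k -> X} :=
  GAction pow_act1 pow_actM pow_act_continuous.

End power_gactions.

Section equivariant_notions.
Context {G : topologicalGroupType} {Z : topologicalType}.
Variable a : gaction G Z.

Definition ginvariant (A : set Z) := forall g z, A z -> A (a g z).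

Definition gcompletely_normal :=
  forall A B : set Z, ginvariant A -> ginvariant B ->
    closure A `&` B = set0 -> A `&` closure B = set0 ->
    exists U V : set Z,
      [/\ open U, open V, ginvariant U & ginvariant V] /\
      [/\ A `<=` U, B `<=` V & U `&` V = set0].

End equivariant_notions.

Section path_space.
Variables (R : realType) (X : topologicalType).

Definition unit_interval : set R := `[0, 1].

Definition path_space : Type := continuousType unit_interval X.

HB.instance Definition _ := Choice.on path_space.
HB.instance Definition _ := Topological.copy path_space
  (initial_topology (id : path_space -> {compact-open, unit_interval -> X})).

Lemma node_subproof k (i : 'I_k) : (i%:R / k.-1%:R : R) \in unit_interval.
Proof.
apply/mem_set; rewrite /unit_interval /= in_itv /= divr_ge0 //=.
case: k i => [[]//|[|k] i /=]; first by rewrite invr0 mulr0.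
by rewrite ler_pdivrMr ?ltr0n // mul1r ler_nat -ltnS.
Qed.

Definition node k (i : 'I_k) : unit_interval :=
  exist (fun t : R => t \in unit_interval) _ (node_subproof i).

Definition path_eval k (alpha : path_space) : {ptws 'I_k -> X} :=
  fun i => (alpha : unit_interval -> X) (node i).

End path_space.

Arguments unit_interval : clear implicits.
Arguments node R {k} i.
Arguments path_eval {R X} k alpha.

(* The values n are taken positive: this matters only for covers of the empty *)
(* space, where n = 0 would make the product inequality read 0 <= 0 + 0 - 1.  *)
Definition least_pos (P : nat -> Prop) : \bar int :=
  match pselect (exists n, `[< (0 < n)%N /\ P n >]) with
  | left ex => (ex_minn ex)%:Z%:E
  | right _ => +oo%E
  end.

Section topological_complexity.
Variables (R : realType) (G : topologicalGroupType) (X : topologicalType).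
Variable k : nat.

Definition has_section (U : set {ptws 'I_k -> X}) :=
  exists s : U -> path_space R X,
    continuous s /\ forall x : U, path_eval k (s x) = \val x.

Definition has_cover (H : topologicalGroupType)
    (b : gaction H {ptws 'I_k -> X}) (n : nat) :=
  exists U : 'I_n -> set {ptws 'I_k -> X},
    \bigcup_i U i = setT /\
    forall i, [/\ open (U i), ginvariant b (U i) & has_section (U i)].

Definition TC_sharp (a : gaction G X) : \bar int :=
  least_pos (has_cover (diag_gaction k a)).

Definition TC_sharp_star (a : gaction G X) : \bar int :=
  least_pos (has_cover (pow_gaction k a)).

End topological_complexity.

(* Main.v *)
Require Import Defs.
From mathcomp Require Import all_boot all_order all_algebra.
From mathcomp Require Import all_classical all_reals all_analysis.

(** Let U_0, ..., U_(n-1) cover X^k and V_0, ..., V_(m-1) cover Y^k by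
    invariant open sets with sections. The n * m products U_i x V_j cover
    X^k x Y^k, and the point is to merge them into n + m - 1 sets, one for each
    value s of i + j. The sets U_i x V_(s-i) overlap, so sections over them do
    not glue; one shrinks them first. Let U'_i be U_i minus the earlier U_j, and
    V'_j likewise. The products U'_i x V'_j partition X^k x Y^k, and on a
    diagonal i + j = s they are separated: of two distinct index pairs one is
    larger in the first coordinate and the other in the second, and the closure
    of U'_j misses every earlier U_i ([closure_seqDU], [closure_seqDU_setX]).
    Equivariant complete normality thickens a finite separated invariant
    family to a pairwise disjoint family of invariant open sets
    ([gcompletely_normal_family]), which may be cut down to stay inside
    U_i x V_(s-i) ([diagonal_expansion]). Over a disjoint union of open sets
    local sections glue ([has_section_bigcup]), so the union of the s-th
    diagonal is a legitimate member of a cover of (X x Y)^k. As i < n and j < m,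
    s takes n + m - 1 values ([has_cover_prod]).

    Two facts are needed to move sections from X and Y to X x Y. The
    homeomorphism from (X x Y)^k to X^k x Y^k is equivariant, along the identity
    of G1 x G2 for the diagonal actions, and along the same homeomorphism for
    groups for the componentwise ones; this lets one argument serve both
    inequalities. And pairing a path in X with a path in Y is continuous for the
    compact-open topologies, which follows from the exponential law
    ([continuous_path_spaceP]), [0, 1] being compact and Hausdorff. *)

Set Implicit Arguments.
Unset Strict Implicit.
Unset Printing Implicit Defensive.

Import Order.TTheory GRing.Theory Num.Theory.
Import numFieldNormedType.Exports.

Local Open Scope classical_set_scope.

(** * Topology of subtypes and of path spaces *)

Section set_type_topology.
Context {T : topologicalType} {A : set T}.

Lemma continuous_set_val : continuous (\val : A -> T).
Proof. exact: (@initial_continuous A T set_val). Qed.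

Lemma nbhs_set_typeP (x : A) (N : set A) :
  nbhs x N <-> exists2 W, nbhs (\val x) W & \val @^-1` W `<=` N.
Proof.
split=> [[_ [[W oW <-] Wx WN]]|[W xW WN]].
  by exists W => //; apply: open_nbhs_nbhs.
by apply: filterS WN _; apply: continuous_set_val.
Qed.

Lemma hausdorff_set_type : hausdorff_space T -> hausdorff_space A.
Proof.
move=> hT x y xy; apply: val_inj; apply: hT => B C xB yC.
have [z [Bz Cz]] := xy _ _ (continuous_set_val xB) (continuous_set_val yC).
by exists (\val z).
Qed.

Lemma compact_set_type : compact A -> compact [set: A].
Proof.
move=> cA F FF _.
have [|x [Ax Fx]] := cA (\val @ F) _.
  by apply: (@filterS _ F _ setT) => [z _|]; [exact: set_valP|exact: filterT].
exists (exist _ x (mem_set Ax)); split=> // B N FB /nbhs_set_typeP[W xW WN].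
have [|_ [[z Bz <-] Wz]] := Fx (\val @` B) W _ xW.
  by apply: (@filterS _ F _ B) => // z Bz; exists z.
by exists z; split=> //; exact: WN.
Qed.

End set_type_topology.

Section path_space_exponential.
Variables (R : realType) (X : topologicalType).

Lemma unit_interval_locally_compact : locally_compact [set: unit_interval R].
Proof.
move=> t _; rewrite withinET.
exists [set: unit_interval R]; first exact: filterT.
split; last exact: closedT.
by apply: compact_set_type; exact: segment_compact.
Qed.

Lemma unit_interval_hausdorff : hausdorff_space (unit_interval R).
Proof. by apply: hausdorff_set_type; exact: Rhausdorff. Qed.

(** Exponential law: a map into the path space is continuous as soon as it is
    jointly continuous in the parameter and in time, and conversely because
    [0, 1] is locally compact Hausdorff. All continuity of path-valued maps goes
    through this form, in which paths are combined pointwise. *)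
Lemma continuous_path_spaceP (S : topologicalType) (s : S -> path_space R X) :
  continuous s <->
  continuous (fun p : S * unit_interval R => (s p.1 : _ -> X) p.2).
Proof.
pose f : S -> {compact-open, unit_interval R -> X} := s.
split=> [cs|cf].
  rewrite (_ : (fun p => _) = uncurry f); last by apply/funext => -[].
  apply: continuous_uncurry.
  - exact: unit_interval_locally_compact.
  - exact: unit_interval_hausdorff.
  - apply: (@continuous_comp_fun S (path_space R X)
      {compact-open, unit_interval R -> X} s id cs).
    exact: (@initial_continuous (path_space R X)
      {compact-open, unit_interval R -> X} id).
  - by move=> u; exact: cts_fun.
apply: (@continuous_comp_initial _ _ _
  (id : path_space R X -> {compact-open, unit_interval R -> X})).
exact: (@continuous_curry_fun _ _ _ (fun p => (s p.1 : _ -> X) p.2)).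
Qed.

End path_space_exponential.

(** * Sections of the path evaluation *)

(** Openness makes each piece a neighbourhood of its points, and disjointness
    makes the piece containing a point unique, so the index of that piece is a
    locally constant function of the point. *)
Lemma continuous_glue (Z T : topologicalType) (I : Type) (U : I -> set Z)
    (s : forall i, U i -> T) :
  (forall i, open (U i)) -> trivIset setT U -> (forall i, continuous (s i)) ->
  exists2 s' : \bigcup_i U i -> T, continuous s' &
    forall i (x : U i) y, \val y = \val x -> s' y = s i x.
Proof.
move=> oU tU cs.
have ex (y : \bigcup_i U i) : exists i, U i (\val y).
  by have [i _ Uiy] := set_valP y; exists i.
(* The index is chosen classically; by disjointness the choice is forced. *)
pose idx y := projT1 (cid (ex y)).
have Uidx y : U (idx y) (\val y) := projT2 (cid (ex y)).
pose s' y : T := s (idx y) (exist _ (\val y) (mem_set (Uidx y))).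
have s'E i (x : U i) y : \val y = \val x -> s' y = s i x.
  move=> yx; rewrite /s'; move: (mem_set (Uidx y)).
  have -> : idx y = i.
    apply: tU => //; exists (\val y); split=> //.
    by rewrite yx; exact: set_valP.
  by move=> ?; congr s; exact: val_inj.
exists s' => // y N; rewrite /s' => /cs /nbhs_set_typeP[W yW WN].
apply/nbhs_set_typeP; exists (W `&` U (idx y)).
  by apply: filterI => //; exact: open_nbhs_nbhs.
move=> z [Wz Uz]; change (N (s' z)).
by rewrite (s'E _ (exist _ (\val z) (mem_set Uz))) //; exact: WN.
Qed.

Definition unzip_pow (X Y : topologicalType) (k : nat)
    (p : {ptws 'I_k -> (X * Y)%type}) : {ptws 'I_k -> X} * {ptws 'I_k -> Y} :=
  (fun i => (p i).1, fun i => (p i).2).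

Lemma unzip_pow_continuous (X Y : topologicalType) (k : nat) :
  continuous (@unzip_pow X Y k).
Proof.
apply: continuous_pair; apply: continuous_ptws => i.
- exact: (continuous_comp_fun (@continuous_ptws_proj _ _ i) continuous_fst).
- exact: (continuous_comp_fun (@continuous_ptws_proj _ _ i) continuous_snd).
Qed.

Section sections.
Variables (R : realType) (k : nat).

Lemma has_section0 (X : topologicalType) :
  has_section R (set0 : set {ptws 'I_k -> X}).
Proof.
have F (x : (set0 : set {ptws 'I_k -> X})) : False by case: (set_valP x).
by exists (fun x => False_rect _ (F x)); split=> x; case: (F x).
Qed.

Lemma has_section_bigcup (X : topologicalType) (I : Type)
    (U : I -> set {ptws 'I_k -> X}) :
  (forall i, open (U i)) -> trivIset setT U ->
  (forall i, has_section R (U i)) -> has_section R (\bigcup_i U i).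
Proof.
move=> oU tU secU.
have {}secU i := cid (secU i).
have [|s cs sE] := continuous_glue (s := fun i => projT1 (secU i)) oU tU.
  by move=> i; have [] := projT2 (secU i).
exists s; split=> // y; have [i _ Uiy] := set_valP y.
rewrite (sE i (exist _ (\val y) (mem_set Uiy))) //.
by have [_ ->] := projT2 (secU i).
Qed.

Lemma has_section_prod (X Y : topologicalType)
    (U : set {ptws 'I_k -> X}) (V : set {ptws 'I_k -> Y})
    (W : set {ptws 'I_k -> (X * Y)%type}) :
  has_section R U -> has_section R V ->
  W `<=` @unzip_pow X Y k @^-1` (U `*` V) -> has_section R W.
Proof.
move=> [s [/continuous_path_spaceP cs sE]] [t [/continuous_path_spaceP ct tE]].
move=> WUV.
have WU (p : W) : U (unzip_pow (\val p)).1 by have [] := WUV _ (set_valP p).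
have WV (p : W) : V (unzip_pow (\val p)).2 by have [] := WUV _ (set_valP p).
pose u (p : W) : U := exist (fun x => x \in U) _ (mem_set (WU p)).
pose v (p : W) : V := exist (fun x => x \in V) _ (mem_set (WV p)).
have cu : continuous u.
  apply: (@continuous_comp_initial _ _ _ (\val : U -> _)).
  apply: (@continuous_comp_fun W _ _ _ fst); last exact: continuous_fst.
  apply: continuous_comp_fun; first exact: continuous_set_val.
  exact: unzip_pow_continuous.
have cv : continuous v.
  apply: (@continuous_comp_initial _ _ _ (\val : V -> _)).
  apply: (@continuous_comp_fun W _ _ _ snd); last exact: continuous_snd.
  apply: continuous_comp_fun; first exact: continuous_set_val.
  exact: unzip_pow_continuous.
have cst p : continuous
    (fun r : unit_interval R => ((s (u p) : _ -> X) r, (t (v p) : _ -> Y) r)).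
  by apply: continuous_pair; exact: cts_fun.
pose st (p : W) : path_space R (X * Y)%type := mkcts (@cst p).
exists st; split.
  apply/continuous_path_spaceP; apply: continuous_pair.
  - apply: (@continuous_comp_fun _ _ _ (fun p : W * _ => (u p.1, p.2)) _ _ cs).
    apply: continuous_pair; last exact: continuous_snd.
    exact: (continuous_comp_fun continuous_fst cu).
  - apply: (@continuous_comp_fun _ _ _ (fun p : W * _ => (v p.1, p.2)) _ _ ct).
    apply: continuous_pair; last exact: continuous_snd.
    exact: (continuous_comp_fun continuous_fst cv).
move=> p; apply/funext => i; rewrite [RHS]surjective_pairing.
by congr pair; [exact: (congr1 (@^~ i) (sE (u p)))
               |exact: (congr1 (@^~ i) (tE (v p)))].
Qed.

End sections.

(** * Invariant sets and equivariant complete normality *)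

Section invariant_sets.
Context {G : topologicalGroupType} {Z : topologicalType} (a : gaction G Z).

Lemma ginvariantC (A : set Z) : ginvariant a A -> ginvariant a (~` A).
Proof.
move=> iA g z nAz Agz; apply: nAz.
by have := iA (g^-1)%g _ Agz; rewrite -gactM mulVg gact1.
Qed.

Lemma ginvariantI (A B : set Z) :
  ginvariant a A -> ginvariant a B -> ginvariant a (A `&` B).
Proof. by move=> iA iB g z [Az Bz]; split; [exact: iA|exact: iB]. Qed.

Lemma ginvariant_bigcup (I : Type) (D : set I) (A : I -> set Z) :
  (forall i, D i -> ginvariant a (A i)) -> ginvariant a (\bigcup_(i in D) A i).
Proof. by move=> iA g z [i Di Az]; exists i => //; exact: iA. Qed.

Lemma ginvariant_seqDU (A : nat -> set Z) (n : nat) :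
  (forall i, ginvariant a (A i)) -> ginvariant a (seqDU A n).
Proof.
move=> iA; rewrite /seqDU -bigcup_mkord setDE; apply: ginvariantI => //.
by apply: ginvariantC; exact: ginvariant_bigcup.
Qed.

(** Separating the members two by two and intersecting, for each member, its
    finitely many neighbourhoods yields disjoint neighbourhoods of all of
    them. *)
Lemma gcompletely_normal_family (I : finType) (C : I -> set Z) :
  gcompletely_normal a -> (forall i, ginvariant a (C i)) ->
  (forall i j, i != j -> closure (C i) `&` C j = set0) ->
  exists W : I -> set Z,
    [/\ forall i, open (W i), forall i, ginvariant a (W i),
        forall i, C i `<=` W i & trivIset setT W].
Proof.
move=> cn iC sepC.
have /choice[N NP] (ij : I * I) : exists N : set Z * set Z, ij.1 != ij.2 ->
    [/\ open N.1, open N.2, ginvariant a N.1 & ginvariant a N.2] /\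
    [/\ C ij.1 `<=` N.1, C ij.2 `<=` N.2 & N.1 `&` N.2 = set0].
  case: ij => i j /=; have [_|ij] := eqVneq i j; first by exists (set0, set0).
  have [||U [V UV]] := cn _ _ (iC i) (iC j); first exact: sepC.
    by rewrite setIC; apply: sepC; rewrite eq_sym.
  by exists (U, V).
(* Each unordered pair is separated twice, as (i, j) and as (j, i); using both
   avoids ordering I, and the separation of (i, j) alone gives disjointness of
   W i and W j. *)
pose W i := [set z | forall j, i != j -> (N (i, j)).1 z /\ (N (j, i)).2 z].
exists W; split=> [i|i g z Wz j ij|i z Cz j ij|i j _ _ [z [Wiz Wjz]]].
- rewrite openE => z Wz; apply: filter_forall => j.
  have [->|ij] := eqVneq i j; first exact: nearW.
  have [[op1 _ _ _] _] := NP (i, j) ij.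
  have ji : j != i by rewrite eq_sym.
  have [[_ op2 _ _] _] := NP (j, i) ji.
  have [N1 N2] := Wz j ij.
  apply: filterS (filterI (open_nbhs_nbhs (conj op1 N1))
    (open_nbhs_nbhs (conj op2 N2))) => z' [? ?] _.
  by split.
- have [N1 N2] := Wz j ij; have ji : j != i by rewrite eq_sym.
  have [[_ _ i1 _] _] := NP (i, j) ij; have [[_ _ _ i2] _] := NP (j, i) ji.
  by split; [exact: i1|exact: i2].
- have ji : j != i by rewrite eq_sym.
  have [_ [C1 _ _]] := NP (i, j) ij; have [_ [_ C2 _]] := NP (j, i) ji.
  by split; [exact: C1|exact: C2].
- apply: contrapT => /eqP ij; have ji : j != i by rewrite eq_sym.
  have [_ [_ _ N0]] := NP (i, j) ij.
  suff: set0 z by [].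
  by rewrite -N0; split; [have [] := Wiz j ij|have [] := Wjz i ji].
Qed.

End invariant_sets.

(** The complement of [A i] is closed and contains [seqDU A j]. *)
Lemma closure_seqDU (Z : topologicalType) (A : nat -> set Z) (i j : nat) :
  (forall i, open (A i)) -> (i < j)%N -> closure (seqDU A j) `<=` ~` A i.
Proof.
move=> oA ij; rewrite closureE => z; apply; split; first exact: open_closedC.
by move=> w [_ nA] Aw; apply: nA; rewrite -bigcup_mkord; exists i.
Qed.

Lemma open_setX (S T : topologicalType) (A : set S) (B : set T) :
  open A -> open B -> open (A `*` B).
Proof.
move=> oA oB; rewrite -[_ `*` _]/((fst @^-1` A) `&` (snd @^-1` B)).
by apply: openI; apply: open_comp => // z _;
  [exact: continuous_fst|exact: continuous_snd].
Qed.

(** * Diagonals of a product of two covers *)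

Section product_of_covers.
Context {G1 G2 : topologicalGroupType} {Z1 Z2 : topologicalType}.
Variables (b1 : gaction G1 Z1) (b2 : gaction G2 Z2).
Variables (U : nat -> set Z1) (V : nat -> set Z2).
Hypotheses (oU : forall i, open (U i)) (oV : forall j, open (V j)).
Hypotheses (iU : forall i, ginvariant b1 (U i)).
Hypotheses (iV : forall j, ginvariant b2 (V j)).

(** If [i' < i] the closure misses the other product in the first coordinate;
    otherwise [i < i'], hence [j' < j], and it does so in the second one. *)
Lemma closure_seqDU_setX (i j i' j' : nat) : (i + j = i' + j')%N -> i <> i' ->
  closure (seqDU U i `*` seqDU V j) `&` (seqDU U i' `*` seqDU V j') = set0.
Proof.
move=> ijE ii'; apply/seteqP; split=> // -[z1 z2] [clz [[Uz _] [Vz _]]].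
have clz1 : closure (seqDU U i) z1.
  move=> B zB; have [|[w1 w2] [[? _] ?]] := clz (fst @^-1` B).
    exact: (@continuous_fst Z1 Z2 (z1, z2)).
  by exists w1.
have clz2 : closure (seqDU V j) z2.
  move=> B zB; have [|[w1 w2] [[_ ?] ?]] := clz (snd @^-1` B).
    exact: (@continuous_snd Z1 Z2 (z1, z2)).
  by exists w2.
have [lt|lt|//] := ltngtP i i'; last first.
  exact: (closure_seqDU oU lt clz1).
have jj' : (j' < j)%N by rewrite -(ltn_add2l i) ijE ltn_add2r.
exact: (closure_seqDU oV jj' clz2).
Qed.

(** The differences are only locally closed, whereas sections glue over disjoint
    open sets: the pieces of one diagonal are replaced by disjoint open sets
    that are still small enough to carry the product sections. *)
Lemma diagonal_expansion (s : nat) :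
  gcompletely_normal (prod_gaction b1 b2) ->
  exists W : 'I_s.+1 -> set (Z1 * Z2),
    [/\ forall i, open (W i) /\ ginvariant (prod_gaction b1 b2) (W i),
        trivIset setT W,
        forall i : 'I_s.+1, W i `<=` U i `*` V (s - i) &
        forall i : 'I_s.+1, seqDU U i `*` seqDU V (s - i) `<=` W i].
Proof.
move=> cn; pose C (i : 'I_s.+1) := seqDU U i `*` seqDU V (s - i).
have iC i : ginvariant (prod_gaction b1 b2) (C i).
  by move=> g z [z1 z2]; split; apply: ginvariant_seqDU.
have sepC i j : i != j -> closure (C i) `&` C j = set0.
  move=> ij; apply: closure_seqDU_setX; last first.
    by move=> /val_inj /eqP; exact/negP.
  by rewrite !subnKC // -ltnS.
have [W [oW iW CW tW]] := gcompletely_normal_family cn iC sepC.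
exists (fun i => W i `&` (U i `*` V (s - i))); split=> [i| |i|i].
- split; first by apply: openI => //; exact: open_setX.
  apply: ginvariantI => // g z [z1 z2].
  by split; [exact: iU|exact: iV].
- by move=> i j _ _ [z [[Wi _] [Wj _]]]; apply: tW => //; exists z.
- by move=> z [].
- move=> z Cz; split; first exact: CW.
  by case: Cz => -[? _] [? _].
Qed.

End product_of_covers.

(** * Covers and the numerical inequality *)

(** Extending a finite cover by empty sets, over which a section exists
    vacuously, frees the diagonals [i + j = s] from range conditions: those that
    stick out of the n by m rectangle are harmless. *)
Lemma has_cover_nat (R : realType) (X : topologicalType) (k : nat)
    (H : topologicalGroupType) (b : gaction H {ptws 'I_k -> X}) (n : nat) :
  has_cover R b n ->
  exists U : nat -> set {ptws 'I_k -> X},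
    (forall x, exists2 i, (i < n)%N & seqDU U i x) /\
    forall i, [/\ open (U i), ginvariant b (U i) & has_section R (U i)].
Proof.
move=> [U [UT UP]]; pose U' i := if insub i is Some o then U o else set0.
exists U'; split=> [x|i]; last first.
  rewrite /U'; case: insubP => [i0 _ _|_]; first exact: UP.
  by split; [exact: open0|by []|exact: has_section0].
have [i _ Ui] : (\bigcup_i U i) x by rewrite UT.
have : (\bigcup_i U' i) x by exists i => //; rewrite /U' valK.
rewrite seqDU_bigcup_eq => -[j _ Uj]; exists j => //.
by case: Uj; rewrite /U'; case: insubP.
Qed.

(** The hypothesis relating [b] to [b1] and [b2] makes the preimage of an
    invariant set invariant. Letting [H] differ from [H1 * H2] covers the
    componentwise action, whose group is a power of a product rather than a
    product of powers. *)
Lemma has_cover_prod (R : realType) (X Y : topologicalType) (k : nat)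
    (H1 H2 H : topologicalGroupType)
    (b1 : gaction H1 {ptws 'I_k -> X}) (b2 : gaction H2 {ptws 'I_k -> Y})
    (b : gaction H {ptws 'I_k -> (X * Y)%type}) (n m : nat) :
  (forall h, exists g, forall p,
    unzip_pow (b h p) = prod_gaction b1 b2 g (unzip_pow p)) ->
  gcompletely_normal (prod_gaction b1 b2) ->
  has_cover R b1 n -> has_cover R b2 m -> has_cover R b (n + m).-1.
Proof.
move=> bE cn /has_cover_nat[U [Un UP]] /has_cover_nat[V [Vm VP]].
have WP s : exists W : 'I_s.+1 -> set ({ptws 'I_k -> X} * {ptws 'I_k -> Y}),
    [/\ forall i, open (W i) /\ ginvariant (prod_gaction b1 b2) (W i),
        trivIset setT W,
        forall i : 'I_s.+1, W i `<=` U i `*` V (s - i) &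
        forall i : 'I_s.+1, seqDU U i `*` seqDU V (s - i) `<=` W i].
  by apply: diagonal_expansion => // i; case: (UP i); case: (VP i).
pose W s := projT1 (cid (WP s)).
have oW s i : open (W s i) by have [/(_ i)[]] := projT2 (cid (WP s)).
have iW s i : ginvariant (prod_gaction b1 b2) (W s i).
  by have [/(_ i)[]] := projT2 (cid (WP s)).
have tW s : trivIset setT (W s) by have [] := projT2 (cid (WP s)).
have WUV s (i : 'I_s.+1) : W s i `<=` U i `*` V (s - i).
  by have [_ _ /(_ i)] := projT2 (cid (WP s)).
have DW s (i : 'I_s.+1) : seqDU U i `*` seqDU V (s - i) `<=` W s i.
  by have [_ _ _ /(_ i)] := projT2 (cid (WP s)).
pose T s i := @unzip_pow X Y k @^-1` W s i.
have oT s i : open (T s i).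
  by apply: open_comp => // p _; exact: unzip_pow_continuous.
exists (fun s : 'I_(n + m).-1 => \bigcup_i T s i); split.
  apply/seteqP; split=> // p _.
  have [i ltin Ui] := Un (unzip_pow p).1.
  have [j ltjm Vj] := Vm (unzip_pow p).2.
  have lts : (i + j < (n + m).-1)%N.
    case: n ltin {Un} => // n ltin; case: m ltjm {Vm} => // m ltjm.
    by rewrite addnS addSn /= ltnS leq_add.
  exists (Ordinal lts) => //=; exists (inord i) => //; apply: DW.
  by rewrite inordK ?ltnS ?leq_addr // addKn.
move=> s; split; first by apply: bigcup_open => i _; exact: oT.
  apply: ginvariant_bigcup => i _ h p Tp; rewrite /T /preimage /=.
  by have [g ->] := bE h; exact: iW.
apply: has_section_bigcup => // [i j _ _ [p [Wi Wj]]|i].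
  by apply: (tW s) => //; exists (unzip_pow p).
have [_ _ secU] := UP i; have [_ _ secV] := VP (s - i)%N.
by apply: (has_section_prod secU secV) => p; exact: WUV.
Qed.

(** If one of the two numbers is infinite, so is the right-hand side; otherwise
    positivity of both minima makes their sum minus one a positive candidate. *)
Lemma least_pos_le_add (P Q S : nat -> Prop) :
  (forall n m, P n -> Q m -> S (n + m).-1) ->
  (least_pos S <= least_pos P + least_pos Q - 1)%E.
Proof.
move=> PQS; rewrite /least_pos.
case: (pselect (exists n, `[< (0 < n)%N /\ P n >])) => [exP|_]; last first.
  by case: (pselect (exists n, `[< (0 < n)%N /\ Q n >])) => ?; exact: leey.
case: (pselect (exists n, `[< (0 < n)%N /\ Q n >])) => [exQ|_]; last first.
  exact: leey.
case: (ex_minnP exP) => n /asboolP[n0 Pn] _.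
case: (ex_minnP exQ) => m /asboolP[m0 Qm] _.
have nm0 : (0 < (n + m).-1)%N.
  by case: n m n0 m0 {Pn Qm} => [|n] [|m] //; rewrite addnS.
have Snm : `[< (0 < (n + m).-1)%N /\ S (n + m).-1 >].
  by apply/asboolP; split=> //; exact: PQS.
case: pselect => [exS|noS]; last by case: noS; exists (n + m).-1.
case: (ex_minnP exS) => r _ /(_ _ Snm) rnm.
have -> : (n%:Z%:E + m%:Z%:E - 1 = (n + m).-1%:Z%:E :> \bar int)%E.
  by congr EFin; rewrite -PoszD -subn1 -subzn // addn_gt0 n0.
by rewrite lee_fin lez_nat.
Qed.

Local Open Scope ereal_scope.

Theorem proposition3p28 (R : realType) (k : nat) (hk : (2 <= k)%N)
    (G1 G2 : topologicalGroupType) (X Y : topologicalType)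
    (aX : gaction G1 X) (aY : gaction G2 Y) :
  (gcompletely_normal (prod_gaction (diag_gaction k aX) (diag_gaction k aY)) ->
   TC_sharp R k (prod_gaction aX aY) <=
     TC_sharp R k aX + TC_sharp R k aY - 1) /\
  (gcompletely_normal (prod_gaction (pow_gaction k aX) (pow_gaction k aY)) ->
   TC_sharp_star R k (prod_gaction aX aY) <=
     TC_sharp_star R k aX + TC_sharp_star R k aY - 1).
Proof.
split=> cn; apply: least_pos_le_add => n m; apply: has_cover_prod cn => g.
- by exists g.
- by exists (unzip_pow g).
Qed.
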